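(* Let $N\in\mathbb N$ and $(\mathfrak L,\Lambda)\in\mathbf{StIP}_N\times\mathbf S_N$. Then for all $(\mathfrak s,\sigma),(\mathfrak t,\tau)\in\bigcup_{n\in\mathbb N}\mathbf{StIP}_n\times\mathbf S_n$, $$\big\langle\mathsf{GPC}((\mathfrak L,\Lambda)),(\mathfrak s,\sigma)\big\rangle\,\big\langle\mathsf{GPC}((\mathfrak L,\Lambda)),(\mathfrak t,\tau)\big\rangle=\big\langle\mathsf{GPC}((\mathfrak L,\Lambda)),(\mathfrak s,\sigma)\heartsuit(\mathfrak t,\tau)\big\rangle .$$
   Context: $\mathbb N=\{0,1,2,\dots\}$, $\mathbb N_{\ge1}=\{1,2,\dots\}$, $[n]=\{1,\dots,n\}$, $[0]=\emptyset$. For a finite set $A\subset\mathbb N_{\ge1}$, an interval partition of $A$ is a finite set $\mathcal I$ of non-empty pairwise disjoint sets (blocks) with union $A$, each block being an interval of $\mathbb N_{\ge1}$ (a set of consecutive integers $\{a,a+1,\dots,b\}$). $\mathbf{IP}(A)$ is the set of these ($\mathbf{IP}(\emptyset)=\{\emptyset\}$), $\mathbf{IP}=\bigcup_A\mathbf{IP}(A)$, and $\bigcup\mathcal I$ denotes the ground set of $\mathcal I$. $\mathbf{StIP}_n:=\mathbf{IP}([n])$. $\mathbf S_n$ is the symmetric group on $[n]$ ($\mathbf S_0$ contains only the empty permutation), permutations being written in one-line notation $\sigma=\sigma_1\cdots\sigma_n$. Order: for $\mathcal I,\mathcal J\in\mathbf{IP}$, $\mathcal I\le\mathcal J$ means $\bigcup\mathcal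 I=\bigcup\mathcal J$ and every block of $\mathcal I$ is contained in a block of $\mathcal J$. Standardization of partitions: for $\mathcal I\in\mathbf{IP}$ with $|\bigcup\mathcal I|=n$, $\mathbf{std}(\mathcal I)\in\mathbf{StIP}_n$ is the image of $\mathcal I$, block by block, under the unique order-preserving bijection $\bigcup\mathcal I\to[n]$. Standardization of permutations: for $\sigma\in\mathbf S_n$ and $A=\{a_1<\dots<a_k\}\subset[n]$ (positions), $\mathbf{st}(\sigma|_A)\in\mathbf S_k$ is the permutation with the same relative order as $\sigma_{a_1}\cdots\sigma_{a_k}$. Cliques: for finite $A\subset\mathbb N_{\ge1}$, $\mathbf{cliques}(A)$ is the set of maximal runs of consecutive integers in $A$. For $\mathcal I\in\mathbf{IP}$, $\mathcal I(A):=\{E\cap c\mid E\in\mathcal I,\ c\in\mathbf{cliques}(A)\}\setminus\{\emptyset\}$, an interval partition of $A\cap\bigcup\mathcal I$. Gluing: for $\mathcal I,\mathcal J\in\mathbf{IP}$, let $\sim$ be the smallest equivalence relation on the set of blocks $\mathcal I\cup\mathcal J$ such that $E\sim F$ whenever $E\cap F\neq\emptyset$. Then $\mathcal I\cdot_{\mathrm{glue}}\mathcal J:=\{\bigcup_{X\in[T]_\sim}X\mid T\in\mathcal I\cup\mathcal J\}$. $\mathcal H_{\mathrm{vinc}}$ is the free $\mathbb Q$-vector space on $\bigcup_n\mathbf{StIP}_n\times\mathbf S_n$. Put $\Delta_\heartsuit((\mathfrak g,\gamma)):=\sum_{A\cup A'=\bigcup\mathfrak g}\ \sum_{\mathcal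 I\in\mathbf{IP}(A),\,\mathcal I'\in\mathbf{IP}(A'),\ \mathcal I\cdot_{\mathrm{glue}}\mathcal I'=\mathfrak g}(\mathbf{std}(\mathcal I),\mathbf{st}(\gamma|_A))\otimes(\mathbf{std}(\mathcal I'),\mathbf{st}(\gamma|_{A'}))$ (outer sum over ordered pairs of not necessarily disjoint subsets), and let $\heartsuit$ be the dual bilinear product $(\mathfrak s,\sigma)\heartsuit(\mathfrak t,\tau):=\sum_{(\mathfrak g,\gamma)}\langle(\mathfrak s,\sigma)\otimes(\mathfrak t,\tau),\Delta_\heartsuit((\mathfrak g,\gamma))\rangle\,(\mathfrak g,\gamma)$, for the pairing making basis elements orthonormal (a finite sum). Signature: for $(\mathfrak L,\Lambda)\in\mathbf{StIP}_N\times\mathbf S_N$, $\mathsf{GPC}((\mathfrak L,\Lambda)):\mathcal H_{\mathrm{vinc}}\to\mathbb Q$ is the linear map with $\langle\mathsf{GPC}((\mathfrak L,\Lambda)),(\mathfrak s,\sigma)\rangle:=\#\{A\subset[N]\mid\mathbf{std}(\mathfrak L(A))\ge\mathfrak s,\ \mathbf{st}(\Lambda|_A)=\sigma\}$. *)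

(* Defs.v *)
From HB Require Import structures.
From mathcomp Require Import boolp classical_sets fsbigop cardinality.
From mathcomp Require Import all_boot all_order all_fingroup all_algebra finmap.
From mathcomp Require Import multinomials.freeg.

Set Implicit Arguments.
Unset Strict Implicit.
Unset Printing Implicit Defensive.

Import GRing.Theory.

Local Open Scope fset_scope.
Local Open Scope nat_scope.

(* {a, a+1, ..., b} *)
Definition seg (a b : nat) : {fset nat} := [fset k in iota a (b.+1 - a)].

Lemma mem_seg (a b k : nat) : (k \in seg a b) = (a <= k <= b).
Proof.
rewrite !inE /= mem_iota; apply: andb_id2l => le_ak.
have [le_ab|lt_ba] := leqP a b; first by rewrite subnKC ?ltnS // leqW.
by rewrite (eqP lt_ba) addn0 ltnNge le_ak leqNgt (leq_trans lt_ba).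
Qed.

Definition interval (E : {fset nat}) : bool :=
  (0 \notin E) && [exists a : E, exists b : E, E == seg (val a) (val b)].

Definition interval_partition (A : {fset nat}) (P : {fset {fset nat}}) : bool :=
  [&& fset0 \notin P, trivIfset P, fcover P == A
    & [forall E : P, interval (val E)]].

(* Every set partition of A is a set of subsets of A, see mem_IP. *)
Definition IP (A : {fset nat}) : {fset {fset {fset nat}}} :=
  [fset P in fpowerset (fpowerset A) | interval_partition A P].

Definition StIP (n : nat) : {fset {fset {fset nat}}} := IP (seg 1 n).

Lemma mem_IP (A : {fset nat}) (P : {fset {fset nat}}) :
  (P \in IP A) = interval_partition A P.
Proof.
rewrite !inE /= andb_idl // => /and4P[_ _ /eqP <- _].
rewrite fpowersetE; apply/fsubsetP => E EP; rewrite fpowersetE.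
by apply: bigfcup_sup.
Qed.

Definition le_IP (P Q : {fset {fset nat}}) : bool :=
  (fcover P == fcover Q) && [forall E : P, exists F : Q, val E `<=` val F].

(* The order-preserving bijection from A onto {1, ..., #|A|}. *)
Definition rank (A : {fset nat}) (x : nat) : nat := #|` [fset y in A | y <= x]|.

Definition std (P : {fset {fset nat}}) : {fset {fset nat}} :=
  [fset [fset rank (fcover P) x | x in (E : {fset nat})] | E in P].

Lemma rank_gt0 (A : {fset nat}) (x : nat) : x \in A -> 0 < rank A x.
Proof.
by move=> Ax; rewrite cardfs_gt0; apply/fset0Pn; exists x; rewrite !inE /= Ax leqnn.
Qed.

Lemma rank_le_card (A : {fset nat}) (x : nat) : rank A x <= #|` A|.
Proof. by apply: fsubset_leq_card; apply/fsubsetP => y; rewrite !inE /= => /andP[]. Qed.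

Lemma rank_le (A : {fset nat}) (x y : nat) : x <= y -> rank A x <= rank A y.
Proof.
move=> le_xy; apply: fsubset_leq_card; apply/fsubsetP => z.
by rewrite !inE /= => /andP[-> /leq_trans]; apply.
Qed.

Lemma rankS (A : {fset nat}) (x : nat) : rank A x.+1 = (x.+1 \in A) + rank A x.
Proof.
rewrite /rank; have [Ax|nAx] := boolP (x.+1 \in A).
  rewrite -[RHS](_ : #|` x.+1 |` [fset y in A | y <= x]| = _); last first.
    by rewrite cardfsU1 !inE /= ltnn andbF.
  congr #|` _|; apply/fsetP => y; rewrite !inE /= [y <= x.+1]leq_eqVlt ltnS.
  by have [->|_] := eqVneq y x.+1; rewrite ?Ax.
rewrite add0n; congr #|` _|; apply/fsetP => y.
rewrite !inE /= [y <= x.+1]leq_eqVlt ltnS.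
by have [->|_] := eqVneq y x.+1; rewrite ?(negPf nAx).
Qed.

Lemma rank_lt (A : {fset nat}) (x y : nat) : y \in A -> x < y -> rank A x < rank A y.
Proof.
case: y => // y Ay; rewrite ltnS => /(rank_le A) le_xy.
by rewrite rankS Ay add1n ltnS.
Qed.

Lemma rank_inj (A : {fset nat}) : {in A &, injective (rank A)}.
Proof.
move=> x y Ax Ay eq_xy; have [lt_xy|lt_yx|//] := ltngtP x y.
  by have := rank_lt Ay lt_xy; rewrite eq_xy ltnn.
by have := rank_lt Ax lt_yx; rewrite eq_xy ltnn.
Qed.

Lemma rank_seg (A : {fset nat}) (a b : nat) :
  a <= b -> seg a b `<=` A ->
  [fset rank A x | x in seg a b] = seg (rank A a) (rank A b).
Proof.
move=> le_ab; rewrite -(subnKC le_ab); elim: (b - a) => [|d IHd] sA.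
  rewrite addn0; apply/fsetP => k; rewrite mem_seg -eqn_leq.
  apply/imfsetP/eqP => [[x /=]|<-]; last by exists a => //=; rewrite mem_seg leqnn.
  by rewrite mem_seg -eqn_leq => /eqP <-.
have sA' : seg a (a + d) `<=` A.
  apply: fsubset_trans sA; apply/fsubsetP => x; rewrite !mem_seg => /andP[-> /=].
  by move=> /leq_trans; apply; rewrite addnS leqnSn.
have Ad : (a + d).+1 \in A.
  by apply: (fsubsetP sA); rewrite mem_seg addnS leqnn andbT leqW ?leq_addr.
have -> : seg a (a + d.+1) = (a + d).+1 |` seg a (a + d).
  apply/fsetP => x; rewrite in_fset1U !mem_seg addnS [x <= _.+1]leq_eqVlt ltnS.
  by have [->|_] := eqVneq x (a + d).+1; rewrite //= leqW ?leq_addr.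
rewrite imfsetU imfset_fset1 IHd // addnS rankS Ad add1n.
apply/fsetP => x; rewrite in_fset1U !mem_seg [x <= _.+1]leq_eqVlt ltnS.
have [->|_] := eqVneq x (rank A (a + d)).+1; rewrite //=.
by rewrite leqW // rank_le ?leq_addr.
Qed.

Lemma std_IP (A : {fset nat}) (P : {fset {fset nat}}) :
  P \in IP A -> std P \in StIP #|` A|.
Proof.
rewrite /StIP !mem_IP => /and4P[P0 /trivIfsetP tP /eqP PA /forallP iP].
have subA (E : {fset nat}) : E \in P -> E `<=` A.
  by move=> EP; rewrite -PA; apply: bigfcup_sup.
have cov : fcover (std P) = [fset rank A x | x in A].
  apply/fsetP => k; apply/bigfcupP/imfsetP => /= [[F]|[x]].
    rewrite andbT => /imfsetP[/= E EP ->] /imfsetP[/= x xE ->].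
    by exists x; rewrite ?PA // (fsubsetP (subA E EP)).
  rewrite -{1}PA => /bigfcupP[E]; rewrite andbT => EP xE ->.
  exists [fset rank A y | y in E]; last by apply/imfsetP; exists x.
  by rewrite andbT; apply/imfsetP; exists E => //=; rewrite PA.
apply/and4P; split.
- apply/negP => /imfsetP[/= E EP E0].
  have [E_eq0|[x xE]] := fset_0Vmem E; first by rewrite -E_eq0 EP in P0.
  by have := in_imfset imfset_key (rank (fcover P)) xE; rewrite -E0.
- apply/trivIfsetP => _ _ /imfsetP[/= E EP ->] /imfsetP[/= F FP ->] neq.
  have {}neq : E != F by apply: contra neq => /eqP ->.
  apply/fdisjointP => _ /imfsetP[/= x xE ->]; apply/imfsetP => -[/= y yF].
  rewrite PA => eq_xy; have {eq_xy} xy : x = y.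
    by apply: (@rank_inj A) => //;
      [apply: (fsubsetP (subA E EP)) | apply: (fsubsetP (subA F FP))].
  by have := fdisjointP (tP _ _ EP FP neq) _ xE; rewrite xy yF.
- rewrite cov eqEfcard; apply/andP; split.
    apply/fsubsetP => _ /imfsetP[/= x xA ->].
    by rewrite mem_seg rank_gt0 ?rank_le_card.
  have -> : #|` [fset rank A x | x in A]| = #|` A|.
    by apply: card_in_imfset; exact: rank_inj.
  by rewrite card_fseq undup_id ?iota_uniq // size_iota subn1.
apply/forallP => -[F /= /[dup] FP /imfsetP[/= E EP eqF]].
have [a [b [aE bE eqE]]] : exists a b, [/\ a \in E, b \in E & E = seg a b].
  have /andP[_ /existsP[a /existsP[b /eqP eqE]]] := iP [` EP].
  by exists (val a), (val b); split=> //; apply: valP.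
have le_ab : a <= b by move: aE; rewrite eqE mem_seg => /andP[].
have sE := subA E EP.
have {}eqF : F = seg (rank A a) (rank A b).
  by rewrite eqF PA eqE rank_seg // -eqE.
have aF : rank A a \in F by rewrite eqF mem_seg leqnn rank_le.
have bF : rank A b \in F by rewrite eqF mem_seg leqnn rank_le.
apply/andP; split.
  by rewrite eqF mem_seg negb_and -ltnNge rank_gt0 // (fsubsetP sE).
by apply/existsP; exists [` aF]; apply/existsP; exists [` bF]; rewrite /= eqF.
Qed.

Definition cliques (A : {fset nat}) : {fset {fset nat}} :=
  [fset c in fpowerset A | interval c &
     [forall d : fpowerset A, interval (val d) && (c `<=` val d) ==> (val d == c)]].

Definition restr (P : {fset {fset nat}}) (A : {fset nat}) : {fset {fset nat}} :=
  [fset E `&` c | E in P, c in cliques A] `\ fset0.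

Definition meets (P : {fset {fset nat}}) : rel P :=
  fun E F => val E `&` val F != fset0.

(* As meets is symmetric, its reflexive transitive closure connect is the
   smallest equivalence relation containing it. *)
Definition glue (P Q : {fset {fset nat}}) : {fset {fset nat}} :=
  [fset fcover [fsetval X : P `|` Q | connect (@meets (P `|` Q)) T X]
    | T : P `|` Q].

(* The set {1, ..., n} of positions of a permutation in 'S_n is identified
   with 'I_n = {0, ..., n-1} through i |-> i + 1. *)
Definition pos (n : nat) (A : {set 'I_n}) : {fset nat} :=
  [fset (val i).+1 | i in A].

(* enum_val lists the elements of A in increasing order. *)
Lemma st_subproof (n : nat) (sigma : 'S_n) (A : {set 'I_n}) (i : 'I_#|A|) :
  #|[set j : 'I_#|A| | sigma (enum_val j) < sigma (enum_val i)]| < #|A|.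
Proof.
rewrite -[X in _ < X]card_ord; apply: proper_card; apply/properP; split.
  exact/subsetP.
by exists i; rewrite // inE ltnn.
Qed.

Definition st_fun (n : nat) (sigma : 'S_n) (A : {set 'I_n}) (i : 'I_#|A|) :
  'I_#|A| := Ordinal (st_subproof sigma i).

Lemma st_fun_lt (n : nat) (sigma : 'S_n) (A : {set 'I_n}) (i j : 'I_#|A|) :
  (st_fun sigma i < st_fun sigma j) = (sigma (enum_val i) < sigma (enum_val j)).
Proof.
rewrite /st_fun /=; case: (ltnP (sigma (enum_val i))) => [lt_ij|le_ji].
  apply: proper_card; apply/properP; split.
    by apply/subsetP => k; rewrite !inE => /ltn_trans; apply.
  by exists i; rewrite !inE ?ltnn.
apply/negbTE; rewrite -leqNgt; apply: subset_leq_card.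
by apply/subsetP => k; rewrite !inE => /leq_trans; apply.
Qed.

Lemma st_fun_inj (n : nat) (sigma : 'S_n) (A : {set 'I_n}) :
  injective (@st_fun n sigma A).
Proof.
move=> i j eq_ij; apply/enum_val_inj/(@perm_inj _ sigma)/val_inj => /=.
have lt_sigma := st_fun_lt sigma.
case: (ltngtP (sigma (enum_val i)) (sigma (enum_val j))) => //.
  by rewrite -lt_sigma eq_ij ltnn.
by rewrite -lt_sigma eq_ij ltnn.
Qed.

Definition st (n : nat) (sigma : 'S_n) (A : {set 'I_n}) : 'S_#|A| :=
  perm (@st_fun_inj n sigma A).

Lemma st_lt (n : nat) (sigma : 'S_n) (A : {set 'I_n}) (i j : 'I_#|A|) :
  (st sigma A i < st sigma A j) = (sigma (enum_val i) < sigma (enum_val j)).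
Proof. by rewrite !permE st_fun_lt. Qed.

Definition vinc_deg (n : nat) : choiceType := (StIP n * 'S_n)%type.
Definition vinc : choiceType := {n : nat & vinc_deg n}.
Definition Vinc (n : nat) (s : StIP n) (sigma : 'S_n) : vinc :=
  Tagged vinc_deg (s, sigma).

Definition Hvinc := {freeg vinc / rat}.

(* The tensor square of a free space is the free space on pairs, with
   a (x) b corresponding to (a, b). *)
Definition Hvinc2 := {freeg (vinc * vinc)%type / rat}.

Lemma card_pos (n : nat) (A : {set 'I_n}) : #|` pos A| = #|A|.
Proof.
by rewrite card_imfset /= -?cardE // => i j [] /val_inj.
Qed.

Lemma std_pos_IP (n : nat) (A : {set 'I_n}) (P : IP (pos A)) :
  std (val P) \in StIP #|A|.
Proof. by rewrite -card_pos; apply: std_IP; apply: valP. Qed.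

Definition std_vinc (n : nat) (gamma : 'S_n) (A : {set 'I_n}) (P : IP (pos A)) :
  vinc := Vinc [` std_pos_IP P] (st gamma A).

Definition Delta (b : vinc) : Hvinc2 :=
  let: existT n (g, gamma) := b in
  (\sum_(A : {set 'I_n}) \sum_(A' : {set 'I_n} | A :|: A' == [set: 'I_n])
    \sum_(P : IP (pos A)) \sum_(P' : IP (pos A') | glue (val P) (val P') == val g)
      << (std_vinc gamma P, std_vinc gamma P') >>)%R.

Local Open Scope ring_scope.

Lemma Delta_tag (a b c : vinc) :
  coeff (a, b) (Delta c) != 0 -> (tag c <= tag a + tag b)%N.
Proof.
case: c => n [g gamma] /=; apply: contraR; rewrite -ltnNge => lt_n.
rewrite raddf_sum big1 //= => A _; rewrite raddf_sum big1 //= => A' /eqP AA'.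
rewrite raddf_sum big1 //= => P _; rewrite raddf_sum big1 //= => P' _.
rewrite coeffU mul1r; case: eqP => // -[ea eb]; move: lt_n.
rewrite -ea -eb /= ltnNge -[n in (n <= _)%N]card_ord -cardsT -AA'.
by rewrite (leq_trans (leq_card_setU A A').1).
Qed.

Lemma Delta_finite (a b : vinc) :
  finite_set [set c : vinc | coeff (a, b) (Delta c) != 0]%classic.
Proof.
pose K := (tag a + tag b).+1.
pose f (u : {i : 'I_K & (StIP i * {perm 'I_i})%type}) : vinc :=
  let: existT i p := u in Tagged vinc_deg p.
apply: (@sub_finite_set _ _ (f @` [set: _])%classic).
  move=> c /= /Delta_tag; case: c => n p /= le_n.
  by exists (Tagged (fun i : 'I_K => (StIP i * {perm 'I_i})%type)
    (p : vinc_deg (Ordinal (le_n : n < K)%N))).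
by apply: finite_image; exact: finite_finset.
Qed.

(* The coefficient of (a, b) in Delta c is the pairing of a (x) b with Delta c;
   the sum has finite support by Delta_finite. *)
Definition heart_basis (a b : vinc) : Hvinc :=
  \sum_(c \in [set: vinc]%classic) coeff (a, b) (Delta c) *: << c >>.

Definition heart (x y : Hvinc) : Hvinc :=
  fglift (fun a => fglift (fun b => heart_basis a b) y) x.

Lemma fglift_linear (M : lmodType rat) (f : vinc -> M) : linear (fglift f).
Proof.
have fB := lift_is_additive f.
have f0 : fglift f 0 = 0 by rewrite -[X in fglift f X](subrr 0) fB subrr.
have fN x : fglift f (- x) = - fglift f x by rewrite -sub0r fB f0 sub0r.
have fD x y : fglift f (x + y) = fglift f x + fglift f y.
  by rewrite -{1}[y]opprK fB fN opprK.
move=> c x y; rewrite fD; congr (_ + _).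
rewrite -[in RHS](freeg_sumE x) [c *: x]/(fgscale c x) /fgscale.
rewrite !(big_morph _ fD f0) scaler_sumr.
by apply: eq_bigr => b _; rewrite !liftU scalerA.
Qed.

Lemma heart_linearl (y : Hvinc) : linear (heart^~ y).
Proof. exact: fglift_linear. Qed.

Lemma heart_linearr (x : Hvinc) : linear (heart x).
Proof.
move=> c y z; rewrite /heart -(freeg_sumE x).
pose F y := fglift (fun a => fglift (heart_basis a) y).
have FE t : F t x = \sum_(a <- dom x) coeff a x *: fglift (heart_basis a) t.
  rewrite -{1}(freeg_sumE x) (big_morph (F t) (id1 := 0) (op1 := +%R)).
  - by apply: eq_bigr => a _; rewrite /F liftU.
  - move=> u v.
    have := fglift_linear (fun a => fglift (heart_basis a) t) 1 u v.
    by rewrite !scale1r.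
  - have := fglift_linear (fun a => fglift (heart_basis a) t) (-1) 0 0.
    by rewrite scaler0 addr0 scaleN1r addNr.
rewrite (freeg_sumE x) -/(F _ x) -/(F y x) -/(F z x) !FE scaler_sumr -big_split /=.
by apply: eq_bigr => a _; rewrite fglift_linear scalerDr !scalerA mulrC.
Qed.

Definition GPC_count (N : nat) (L : StIP N) (Lam : 'S_N) (b : vinc) : nat :=
  let: existT n (s, sigma) := b in
  #|[set A : {set 'I_N} | le_IP (val s) (std (restr (val L) (pos A)))
      & Tagged (fun k => 'S_k) (st Lam A) == Tagged (fun k => 'S_k) sigma]|.

Definition GPC (N : nat) (L : StIP N) (Lam : 'S_N) (x : Hvinc) : rat :=
  fglift (fun b => (GPC_count L Lam b)%:R : rat^o) x.

Lemma GPC_basis (N : nat) (L : StIP N) (Lam : 'S_N) (b : vinc) :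
  GPC L Lam << b >> = (GPC_count L Lam b)%:R.
Proof. by rewrite /GPC liftU scale1r. Qed.

Lemma GPC_linear (N : nat) (L : StIP N) (Lam : 'S_N) : scalar (GPC L Lam).
Proof. exact: (@fglift_linear rat^o). Qed.

HB.instance Definition _ (N : nat) (L : StIP N) (Lam : 'S_N) :=
  GRing.isLinear.Build rat Hvinc rat _ (GPC L Lam) (GPC_linear L Lam).

(* Main.v *)
Require Import Defs.
From mathcomp Require classical_sets fsbigop cardinality.
From mathcomp Require Import all_boot all_fingroup all_algebra finmap.
From mathcomp Require Import multinomials.freeg.

(* The left-hand side counts pairs (B, B') of subsets of [N] at which the two
   patterns occur. Such a pair determines C = B u B', and, through the
   order-preserving bijection C -> [#|C|], subsets A, A' covering [#|C|].
   An occurrence of s at B amounts to an interval partition P of A with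
   std P = s which refines std (L(C)): blocks of s pulled back to B are
   intervals of consecutive integers inside blocks of L, and consecutiveness
   survives both restriction to B and extension to C. As glue P P' is the join
   of P and P', it lies below std (L(C)) iff both P and P' refine std (L(C)),
   so the terms of the coproduct of the patterns occurring at C match the pairs
   (B, B') with B u B' = C. *)

Set Implicit Arguments.
Unset Strict Implicit.
Unset Printing Implicit Defensive.

Import GRing.Theory.

Local Open Scope fset_scope.
Local Open Scope nat_scope.

(** * Convex sets, intervals and interval partitions *)

Definition convex (E : {fset nat}) : Prop :=
  forall x y z, x \in E -> z \in E -> x <= y <= z -> y \in E.

Lemma seg_convex a b : convex (seg a b).
Proof.
move=> x y z; rewrite !mem_seg => /andP[ax _] /andP[_ zb] /andP[xy yz].
by rewrite (leq_trans ax) // (leq_trans yz).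
Qed.

Lemma convex_seg (E : {fset nat}) :
  E != fset0 -> convex E -> exists a b, [/\ a \in E, b \in E & E = seg a b].
Proof.
move=> /fset0Pn[x0 x0E] cE.
have exE : exists x, x \in E by exists x0.
have ubE x : x \in E -> x <= \max_(y <- E) y by move=> xE; exact: leq_bigmax_seq.
case: (ex_minnP exE) => a aE amin; case: (ex_maxnP exE ubE) => b bE bmax.
exists a, b; split=> //; apply/fsetP => x; rewrite mem_seg.
by apply/idP/idP => [xE|]; [rewrite amin ?bmax | exact: cE].
Qed.

Lemma fcoverP (P : {fset {fset nat}}) x :
  reflect (exists2 E, E \in P & x \in E) (x \in fcover P).
Proof.
by apply: (iffP (bigfcupP _ _ _ _)) => -[E]; rewrite ?andbT => EP xE; exists E;
  rewrite ?andbT.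
Qed.

(** Convexity replaces the named endpoints, so that being an interval can be checked pointwise after
    intersections, unions and changes of rank. *)
Lemma intervalP (E : {fset nat}) :
  reflect [/\ 0 \notin E, E != fset0 & convex E] (Defs.interval E).
Proof.
apply: (iffP andP) => [[E0 /existsP[a /existsP[b /eqP eqE]]]|[E0 En0 cE]]; split=> //.
- by apply/fset0Pn; exists (val a); apply: valP.
- by rewrite eqE; apply: seg_convex.
have [a [b [aE bE eqE]]] := convex_seg En0 cE.
by apply/existsP; exists [` aE]; apply/existsP; exists [` bE]; apply/eqP.
Qed.

(** Working form of membership in [IP]: disjointness becomes equality of blocks sharing a point, and
    the condition on 0 moves to the ground set. *)
Lemma IPP (A : {fset nat}) (P : {fset {fset nat}}) :
  reflect [/\ 0 \notin A, {in P, forall E : {fset nat}, E != fset0 /\ convex E},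
    {in P &, forall (E F : {fset nat}) x, x \in E -> x \in F -> E = F} & fcover P = A]
  (P \in IP A).
Proof.
rewrite mem_IP; apply: (iffP and4P) => [[P0 /trivIfsetP tP /eqP <- /forallP iP]|].
  have iE E : E \in P -> [/\ 0 \notin E, E != fset0 & convex E].
    by move=> EP; apply/intervalP; have := iP [` EP].
  split=> //.
  - by apply/fcoverP => -[E /iE[/negP]].
  - by move=> E /iE[].
  move=> E F EP FP x xE xF; apply/eqP; apply/contraT => /(tP _ _ EP FP)/fdisjointP/(_
    x xE).
  by rewrite xF.
case=> A0 bP tP cA; split.
- by apply/negP => /bP[]; rewrite eqxx.
- apply/trivIfsetP => E F EP FP; apply: contraNT => /fdisjointP H.
  apply/eqP; have [E0|[x xE]] := fset_0Vmem (E `&` F); last first.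
    by move: xE; rewrite in_fsetI => /andP[]; apply: tP.
  case: H => x xE; apply/negP => xF; have : x \in E `&` F by rewrite in_fsetI xE xF.
  by rewrite E0.
- by rewrite cA.
apply/forallP => -[E EP] /=; have [E0 cE] := bP _ EP; apply/intervalP; split=> //.
by apply: contra A0 => zE; rewrite -cA; apply/fcoverP; exists E.
Qed.

(** * Refinement and gluing *)

(** This is [le_IP] without equality of ground sets: a partition of a part of [[#|C|]] has to be
    compared with one of all of [[#|C|]]. *)
Definition refines (P Q : {fset {fset nat}}) : bool :=
  [forall E : P, exists F : Q, val E `<=` val F].

Lemma refinesP (P Q : {fset {fset nat}}) :
  reflect {in P, forall E, exists2 F, F \in Q & E `<=` F} (refines P Q).
Proof.
apply: (iffP forallP) => [H E EP|H [E EP]].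
  by have /existsP[[F FQ] /= EF] := H [` EP]; exists F.
by have [F FQ EF] := H E EP; apply/existsP; exists [` FQ].
Qed.

Lemma glueP (P Q : {fset {fset nat}}) (G : {fset nat}) :
  reflect (exists T : P `|` Q, forall x, x \in G <->
      exists2 X : P `|` Q, connect (@meets (P `|` Q)) T X & x \in val X)
    (G \in glue P Q).
Proof.
have memG (T : P `|` Q) x :
    reflect (exists2 X : P `|` Q, connect (@meets (P `|` Q)) T X & x \in val X)
      (x \in fcover [fsetval X : P `|` Q | connect (@meets (P `|` Q)) T X]).
  apply: (iffP (fcoverP _ _)) => [[E /imfsetP[/= X + ->]]|[X TX xX]].
    by rewrite inE => TX xX; exists X.
  by exists (val X) => //; apply/imfsetP; exists X; rewrite //= inE.
rewrite /glue; apply: (iffP (imfsetP _ _ _ _)) => [[T _ ->]|[T GT]]; exists T => //.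
  by move=> x; split=> /memG.
by apply/fsetP => x; apply/idP/memG => /GT.
Qed.

Lemma meets_sym (R : {fset {fset nat}}) : connect_sym (@meets R).
Proof. by apply: sym_connect_sym => X Y; rewrite /meets fsetIC. Qed.

(** Universal property of the join. Blocks that meet must lie in the same block of [R], so a whole
    equivalence class does; conversely every block of [P] or [Q] lies in its glued class. *)
Lemma refines_glue (P Q R : {fset {fset nat}}) :
  {in R &, forall (E F : {fset nat}) x, x \in E -> x \in F -> E = F} ->
  refines (glue P Q) R = refines P R && refines Q R.
Proof.
move=> tR; apply/idP/idP => [/refinesP H|/andP[/refinesP HP /refinesP HQ]].
  suff HPQ E : E \in P `|` Q -> exists2 F, F \in R & E `<=` F.
    by apply/andP; split; apply/refinesP => E EP; apply: HPQ; rewrite inE EP ?orbT.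
  move=> EPQ.
  pose G := fcover [fsetval X : P `|` Q | connect (@meets (P `|` Q)) [` EPQ] X].
  have [|F FR GF] := H G; first by apply/imfsetP; exists [` EPQ].
  exists F => //; apply: fsubset_trans GF; apply: bigfcup_sup => //.
  by apply/imfsetP; exists [` EPQ]; rewrite //= inE connect0.
have HPQ E : E \in P `|` Q -> exists2 F, F \in R & E `<=` F.
  by rewrite inE => /orP[]; [apply: HP | apply: HQ].
apply/refinesP => G /glueP[T GT]; have [F FR TF] := HPQ _ (valP T).
exists F => //; apply/fsubsetP => x /GT[X TX]; move: x; apply/fsubsetP.
(* Lying inside [F] propagates along [meets]: a common point of [Y] and [Z] forces the block of [R]
   around [Z] to be [F]. *)
have cl : closed (@meets (P `|` Q)) [pred X | val X `<=` F].
  apply: (intro_closed (@meets_sym _)) => Y Z /fset0Pn[y];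
    rewrite !inE => /andP[yY yZ] YF.
  have [F' F'R ZF'] := HPQ _ (valP Z).
  by rewrite (tR F F' FR F'R y) ?(fsubsetP YF) ?(fsubsetP ZF').
by have := closed_connect cl TX; rewrite !inE TF => <-.
Qed.

Lemma fcover_glue (P Q : {fset {fset nat}}) : fcover (glue P Q) = fcover P `|` fcover Q.
Proof.
apply/fsetP => x; rewrite in_fsetU; apply/fcoverP/idP => [[G /glueP[T GT] /GT[X _ xX]]|].
  by have := valP X; rewrite in_fsetU => /orP[] XP; apply/orP; [left|right];
    apply/fcoverP; exists (val X).
move=> H; have [E EPQ xE] : exists2 E, E \in P `|` Q & x \in E.
  by case/orP: H => /fcoverP[E EP xE]; exists E; rewrite ?in_fsetU ?EP ?orbT.
pose G := fcover [fsetval X : P `|` Q | connect (@meets (P `|` Q)) [` EPQ] X].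
exists G; first by apply/imfsetP; exists [` EPQ].
by apply/fcoverP; exists E => //; apply/imfsetP; exists [` EPQ]; rewrite //= inE connect0.
Qed.

(* If a point k is missed by a union of meeting intervals, then all of them
   lie on the same side of k. *)
Lemma glue_IP (A B : {fset nat}) (P Q : {fset {fset nat}}) :
  P \in IP A -> Q \in IP B -> glue P Q \in IP (A `|` B).
Proof.
move=> /IPP[A0 bP _ cP] /IPP[B0 bQ _ cQ].
have bPQ E : E \in P `|` Q -> E != fset0 /\ convex E.
  by rewrite in_fsetU => /orP[/bP|/bQ].
apply/IPP; split.
- by rewrite in_fsetU negb_or A0.
- move=> G /glueP[T GT]; split.
    have [/fset0Pn[x xT] _] := bPQ _ (valP T).
    by apply/fset0Pn; exists x; apply/GT; exists T; rewrite ?connect0.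
  move=> x k z /GT[X TX xX] /GT[Z TZ zZ] /andP[xk kz]; apply: contraT => nGk.
  have nk Y : connect (@meets (P `|` Q)) T Y -> k \notin val Y.
    by move=> TY; apply: contra nGk => kY; apply/GT; exists Y.
  pose S := [pred Y : P `|` Q | connect (@meets (P `|` Q)) T Y
                 && [exists y : val Y, val y < k]].
  have cl : closed (@meets (P `|` Q)) S.
    apply: (intro_closed (@meets_sym _)) => Y W YW; rewrite !inE.
    move=> /andP[TY /existsP[[y yY] /= yk]].
    have TW : connect (@meets (P `|` Q)) T W := connect_trans TY (connect1 YW).
    rewrite TW /=; have /fset0Pn[w] := YW; rewrite in_fsetI => /andP[wY wW].
    apply/existsP; exists [` wW] => /=; rewrite ltnNge; apply: contra (nk _ TY) => kw.
    by have [_] := bPQ _ (valP Y); apply; first exact: yY; first exact: wY;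
      rewrite (ltnW yk).
  have XZ : connect (@meets (P `|` Q)) X Z.
    by apply: connect_trans TZ; rewrite meets_sym.
  have SX : S X.
    rewrite !inE TX; apply/existsP; exists [` xX] => /=.
    by rewrite ltn_neqAle xk andbT; apply: contra (nk _ TX) => /eqP <-.
  have := closed_connect cl XZ; rewrite !inE in SX *; rewrite SX => /esym/andP[_].
  case/existsP => -[w wZ] /= wk; have := nk _ TZ.
  have [_ cZ] := bPQ _ (valP Z).
  by rewrite (cZ w k z wZ zZ) // (ltnW wk).
- move=> G H /glueP[T GT] /glueP[U HU] x /GT[X TX xX] /HU[Y UY xY].
  have XY : connect (@meets (P `|` Q)) X Y.
    by apply: connect1; apply/fset0Pn; exists x; rewrite in_fsetI xX.
  have TU : connect (@meets (P `|` Q)) T U.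
    by apply: connect_trans TX (connect_trans XY _); rewrite meets_sym.
  apply/fsetP => y; apply/idP/idP => [/GT[Z TZ yZ]|/HU[Z UZ yZ]]; [apply/HU|apply/GT];
    exists Z => //; last exact: connect_trans TU UZ.
  by apply: connect_trans TZ; rewrite meets_sym.
by rewrite fcover_glue cP cQ.
Qed.

(** * Cliques and restriction of partitions *)

Lemma cliqueP (B c : {fset nat}) :
  reflect [/\ c `<=` B, Defs.interval c
     & forall d : {fset nat}, d `<=` B -> Defs.interval d -> c `<=` d -> d = c]
    (c \in cliques B).
Proof.
rewrite !inE /= fpowersetE; apply: (iffP and3P) => [] [cB ic mc]; split=> //.
  move=> d; rewrite -fpowersetE => dB id cd; apply/eqP.
  by have /forallP/(_ [` dB])/implyP := mc; rewrite /= id cd => ->.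
apply/forallP => -[d dB] /=; apply/implyP => /andP[id cd]; apply/eqP.
by apply: mc; rewrite // -fpowersetE.
Qed.

Lemma sub_clique (B d : {fset nat}) :
  d `<=` B -> Defs.interval d -> exists2 c, c \in cliques B & d `<=` c.
Proof.
move=> dB id; have dS : d \in fpowerset B by rewrite fpowersetE.
pose P := [pred c : fpowerset B | Defs.interval (val c) && (d `<=` val c)].
have Pd : P [` dS] by rewrite /= id fsubset_refl.
(* An interval of largest cardinality among those between [d] and [B] is maximal for inclusion. *)
case: (@arg_maxnP _ [` dS] P (fun c => #|` val c|) Pd) => -[c cS] /andP[/= ic dc] cmax.
have cB : c `<=` B by rewrite -fpowersetE.
exists c => //; apply/cliqueP; split=> // e; rewrite -fpowersetE => eS ie ce.
apply/esym/eqP; rewrite eqEfcard ce.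
by apply: (cmax [` eS]); rewrite /= ie (fsubset_trans dc).
Qed.

(** The union of two intervals sharing a point is an interval, so maximality identifies both cliques
    with their union. *)
Lemma clique_inj (B c d : {fset nat}) x :
  c \in cliques B -> d \in cliques B -> x \in c -> x \in d -> c = d.
Proof.
move=> /cliqueP[cB /intervalP[c0 cn0 cc] mc] /cliqueP[dB /intervalP[d0 dn0 cd] md] xc xd.
have cdB : c `|` d `<=` B by rewrite fsubUset cB.
have icd : Defs.interval (c `|` d).
  apply/intervalP; split; first by rewrite in_fsetU negb_or c0.
    by apply/fset0Pn; exists x; rewrite in_fsetU xc.
  move=> u v w ucd wcd /andP[uv vw]; rewrite in_fsetU; apply/orP.
  have [vx|/ltnW xv] := leqP v x.
    by case/fsetUP: ucd => [uc|ud]; [left; apply: (cc u v x)|right; apply: (cd u v x)];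
      rewrite ?uv.
  by case/fsetUP: wcd => [wc|wd]; [left; apply: (cc x v w)|right; apply: (cd x v w)];
    rewrite ?vw ?xv.
by rewrite -(mc _ cdB) ?fsubsetUl // (md _ cdB) ?fsubsetUr.
Qed.

Lemma restrP (L : {fset {fset nat}}) (B E : {fset nat}) :
  reflect [/\ E != fset0 & exists F c, [/\ F \in L, c \in cliques B & E = F `&` c]]
    (E \in restr L B).
Proof.
rewrite in_fsetD1; apply: (iffP andP) => [[En0 /imfset2P[/= F FL [c cB eE]]]|].
  by split=> //; exists F, c.
case=> En0 [F [c [FL cB eE]]]; split=> //.
by apply/imfset2P; exists F => //; exists c.
Qed.

(** Separates the two roles of a block of [restr L B]: its part from [L] bounds [E], and its clique
    says that [B] has no gap between points of [E]. *)
Lemma sub_restr (L : {fset {fset nat}}) (B E : {fset nat}) :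
  0 \notin B -> E != fset0 ->
  (exists2 F, F \in restr L B & E `<=` F) <->
  (exists2 F, F \in L & E `<=` F) /\
  (forall x y z, x \in E -> z \in E -> x <= y <= z -> y \in B).
Proof.
move=> B0 En0; split=> [[G /restrP[_ [F [c [FL cB ->]]]]]|[[F FL EF] hull]].
  rewrite fsubsetI => /andP[EF Ec]; split; first by exists F.
  move=> x y z xE zE xyz; have /cliqueP[/fsubsetP cB' /intervalP[_ _ cc] _] := cB.
  by apply/cB'/(cc x y z) => //; apply: (fsubsetP Ec).
(* [H] is the integer convex hull of [E]; the gap condition puts it inside [B], hence inside one
   clique. *)
pose H := [fset y in B | [exists x : E, exists z : E, val x <= y <= val z]].
have memH y : reflect (exists x z, [/\ x \in E, z \in E & x <= y <= z]) (y \in H).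
  rewrite !inE /=; apply: (iffP andP) => [[yB /existsP[x /existsP[z xyz]]]|].
    by exists (val x), (val z); split=> //; apply: valP.
  case=> x [z [xE zE xyz]]; split; first exact: (hull x y z).
  by apply/existsP; exists [` xE]; apply/existsP; exists [` zE].
have EH : E `<=` H.
  by apply/fsubsetP => x xE; apply/memH; exists x, x; rewrite leqnn.
have HB : H `<=` B by apply/fsubsetP => y /memH[x [z [xE zE]]]; apply: hull.
have iH : Defs.interval H.
  apply/intervalP; split; first by apply: contra B0; apply: (fsubsetP HB).
    by have [x xE] := fset0Pn _ En0; apply/fset0Pn; exists x; apply: (fsubsetP EH).
  move=> x y z /memH[x1 [_ [x1E _ /andP[x1x _]]]] /memH[_ [z2 [_ z2E /andP[_ zz2]]]].
  move=> /andP[xy yz]; apply/memH; exists x1, z2; split=> //.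
  by rewrite (leq_trans x1x) ?(leq_trans yz).
have [c cB Hc] := sub_clique HB iH.
have Ec : E `<=` F `&` c by rewrite fsubsetI EF (fsubset_trans EH).
exists (F `&` c) => //; apply/restrP; split; last by exists F, c.
by have [x xE] := fset0Pn _ En0; apply/fset0Pn; exists x; apply: (fsubsetP Ec).
Qed.

Lemma restr_IP (L : {fset {fset nat}}) (A B : {fset nat}) :
  L \in IP A -> B `<=` A -> restr L B \in IP B.
Proof.
move=> /IPP[A0 bL tL cL] /fsubsetP BA.
have B0 : 0 \notin B by apply: contra A0; apply: BA.
apply/IPP; split=> //.
- move=> E /restrP[En0 [F [c [FL cB eE]]]]; split=> //.
  have [_ cF] := bL _ FL; have /cliqueP[_ /intervalP[_ _ cc] _] := cB.
  rewrite eE => x y z; rewrite !in_fsetI => /andP[xF xc] /andP[zF zc] xyz.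
  by rewrite (cF x y z) // (cc x y z).
- move=> _ _ /restrP[_ [F [c [FL cB ->]]]] /restrP[_ [F' [c' [FL' cB' ->]]]] x.
  rewrite !in_fsetI => /andP[xF xc] /andP[xF' xc'].
  by rewrite (tL F F' FL FL' x) // (clique_inj cB cB' xc).
apply/fsetP => x; apply/fcoverP/idP => [[_ /restrP[_ [F [c [_ cB ->]]]]]|xB].
  by rewrite in_fsetI => /andP[_]; apply/fsubsetP; have /cliqueP[] := cB.
(* A singleton satisfies the gap condition trivially, so [sub_restr] yields a block around [x]. *)
have x0 : [fset x] != fset0 by apply/fset0Pn; exists x; rewrite in_fset1.
have [|F FR xF] := (sub_restr L B0 x0).2; last first.
  by exists F => //; apply: (fsubsetP xF); rewrite in_fset1.
split=> [|u v w /fset1P-> /fset1P->]; last by rewrite -eqn_leq => /eqP <-.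
have : x \in fcover L by rewrite cL BA.
by case/fcoverP => F FL xF; exists F; rewrite // fsub1set.
Qed.

(** * Ranks and the inverse of standardization *)

Lemma fcoverS (P : {fset {fset nat}}) (E : {fset nat}) : E \in P -> E `<=` fcover P.
Proof. by move=> EP; apply: bigfcup_sup. Qed.

Lemma card_rank (B E : {fset nat}) :
  E `<=` B -> #|` [fset rank B x | x in E]| = #|` E|.
Proof.
move=> /fsubsetP EB; apply: card_in_imfset => x y /= xE yE.
by apply: rank_inj; apply: EB.
Qed.

Lemma rank_onto (B : {fset nat}) k :
  k \in seg 1 #|` B| -> exists2 x, x \in B & rank B x = k.
Proof.
have -> : seg 1 #|` B| = [fset rank B x | x in B].
  apply/esym/eqP; rewrite eqEfcard; apply/andP; split.
    by apply/fsubsetP => _ /imfsetP[/= x xB ->]; rewrite mem_seg rank_gt0 ?rank_le_card.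
  by rewrite card_rank ?fsubset_refl // card_fseq undup_id ?iota_uniq // size_iota subn1.
by case/imfsetP => /= x xB ->; exists x.
Qed.

Lemma rank_mono (B : {fset nat}) : {in B &, {mono rank B : x y / x <= y}}.
Proof.
move=> x y xB yB; have [/(rank_le B)//|yx] := leqP x y.
by apply/negbTE; rewrite -ltnNge rank_lt.
Qed.

(** Preimage of a set of ranks under the order-preserving bijection from [B] onto [[#|B|]]. *)
Definition pull (B E : {fset nat}) : {fset nat} := [fset x in B | rank B x \in E].

Lemma mem_pull (B E : {fset nat}) x : (x \in pull B E) = (x \in B) && (rank B x \in E).
Proof. by rewrite !inE. Qed.

Lemma pull_neq0 (B E : {fset nat}) :
  E `<=` seg 1 #|` B| -> E != fset0 -> pull B E != fset0.
Proof.
move=> /fsubsetP EB /fset0Pn[k kE]; have [x xB eq_k] := rank_onto (EB _ kE).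
by apply/fset0Pn; exists x; rewrite mem_pull xB eq_k.
Qed.

Lemma refines_std (P R : {fset {fset nat}}) (B : {fset nat}) :
  fcover R = B -> fcover P `<=` seg 1 #|` B| ->
  refines P (std R) <-> {in P, forall E, exists2 F, F \in R & pull B E `<=` F}.
Proof.
move=> cR /fsubsetP cP; have RB F : F \in R -> F `<=` B by rewrite -cR; apply: fcoverS.
split=> [/refinesP H E EP|H].
  have [_ /imfsetP[/= F FR ->] /fsubsetP EF] := H E EP.
  exists F => //; apply/fsubsetP => x; rewrite mem_pull => /andP[xB /EF].
  case/imfsetP => /= y yF; rewrite cR => /(rank_inj xB) -> //.
  exact: (fsubsetP (RB _ FR)).
apply/refinesP => E EP; have [F FR /fsubsetP EF] := H E EP.
exists [fset rank B x | x in F]; first by apply/imfsetP; exists F; rewrite //= cR.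
apply/fsubsetP => k kE; have kP : k \in fcover P by apply: (fsubsetP (fcoverS EP)).
have [x xB eq_k] := rank_onto (cP _ kP).
by apply/imfsetP; exists x; rewrite //= EF // mem_pull xB eq_k.
Qed.

(** Blockwise criterion in terms of actual points rather than ranks. For blocks with the same
    pullback, criteria at different [B] differ only in the gap condition. *)
Lemma refines_std_restr (L P : {fset {fset nat}}) (A B D : {fset nat}) :
  L \in IP D -> B `<=` D -> P \in IP A -> A `<=` seg 1 #|` B| ->
  refines P (std (restr L B)) <->
  {in P, forall E, (exists2 F, F \in L & pull B E `<=` F) /\
    forall x y z, x \in pull B E -> z \in pull B E -> x <= y <= z -> y \in B}.
Proof.
move=> LD BD /IPP[_ bP _ cP] AB.
have /IPP[B0 _ _ cR] := restr_IP LD BD.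
have En0 E : E \in P -> pull B E != fset0.
  move=> EP; apply: pull_neq0; last by have [] := bP E EP.
  by apply: fsubset_trans AB; rewrite -cP; apply: fcoverS.
rewrite (refines_std cR) ?cP //; split=> H E EP.
  by apply/(sub_restr _ B0 (En0 E EP)); apply: H.
by apply/(sub_restr _ B0 (En0 E EP)); apply: H.
Qed.

(** * Standardization in two stages: a subset of ranks of [C] *)

Section Pull.

Variables (C A : {fset nat}).
Hypothesis AC : A `<=` seg 1 #|` C|.

(** [rank C] maps the points of [pull C A] up to [x] bijectively onto the elements of [A] up to
    [rank C x]. *)
Lemma rank_pull x : x \in C -> rank (pull C A) x = rank A (rank C x).
Proof.
move=> xC; have -> : rank A (rank C x) =
    #|` [fset rank C y | y in [fset y in pull C A | y <= x]]|.
  congr #|` _|; apply/fsetP => k; rewrite !inE /=; apply/andP/imfsetP => /=.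
    move=> [kA kx]; have [y yC eq_k] := rank_onto (fsubsetP AC _ kA).
    by exists y; rewrite // !inE /= yC eq_k kA -(rank_mono yC xC) eq_k.
  by case=> y; rewrite !inE /= => /andP[/andP[yC yA] yx] ->; rewrite yA rank_le.
by rewrite card_rank //; apply/fsubsetP => y; rewrite !inE /= => /andP[/andP[]].
Qed.

Lemma card_pull : #|` pull C A| = #|` A|.
Proof.
have eqA : A = [fset rank C y | y in pull C A].
  apply/fsetP => k; apply/idP/imfsetP => /= [kA|[y]].
    have [y yC eq_k] := rank_onto (fsubsetP AC _ kA).
    by exists y; rewrite // mem_pull yC eq_k.
  by rewrite mem_pull => /andP[_ ?] ->.
by rewrite [in RHS]eqA card_rank //; apply/fsubsetP => x; rewrite mem_pull => /andP[].
Qed.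

Lemma pull_rank (E : {fset nat}) :
  E `<=` A -> pull (pull C A) [fset rank A x | x in E] = pull C E.
Proof.
move=> /fsubsetP EA; apply/fsetP => x; rewrite !mem_pull.
have [xC/=|//] := boolP (x \in C); apply/andP/idP => [[xA]|xE].
  by rewrite rank_pull // => /imfsetP[/= y yE /(rank_inj xA)->//]; apply: EA.
by split; [apply: EA | rewrite rank_pull //; apply/imfsetP; exists (rank C x)].
Qed.

(** By [pull_rank] both sides speak of the same sets of points, so only the gap conditions are
    compared. A point of [C] between two points of a pulled block has its rank in that convex block,
    hence lies in [pull C A]; the converse is the inclusion of [pull C A] in [C]. *)
Lemma refines_pull (L P : {fset {fset nat}}) (D : {fset nat}) :
  L \in IP D -> C `<=` D -> P \in IP A ->
  refines P (std (restr L C)) = refines (std P) (std (restr L (pull C A))).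
Proof.
move=> LD CD PA; have [_ bP _ cP] := IPP _ _ PA.
have EA E : E \in P -> E `<=` A by rewrite -cP; apply: fcoverS.
have BC : pull C A `<=` C by apply/fsubsetP => x; rewrite mem_pull => /andP[].
have BD := fsubset_trans BC CD.
have stdP E : E \in P -> [fset rank A x | x in E] \in std P.
  by move=> EP; apply/imfsetP; exists E; rewrite //= cP.
have H1 := refines_std_restr LD CD PA AC.
have H2 := refines_std_restr LD BD (std_IP PA); rewrite card_pull in H2.
have {}H2 := H2 (fsubset_refl _); apply/idP/idP => [/H1 H|/H2 H].
  apply/H2 => _ /imfsetP[/= E EP ->]; rewrite cP pull_rank ?EA //.
  have [HL HC] := H E EP; split=> // x y z xE zE xyz.
  have yC := HC _ _ _ xE zE xyz; rewrite mem_pull yC; apply: (fsubsetP (EA _ EP)).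
  move: xE zE; rewrite !mem_pull => /andP[xC xE] /andP[zC zE].
  by have [_ cE] := bP _ EP; apply: (cE _ _ _ xE zE); case/andP: xyz => *;
    rewrite !rank_le.
apply/H1 => E EP; have := H _ (stdP E EP); rewrite pull_rank ?EA // => -[HL HB].
by split=> // x y z xE zE xyz; apply: (fsubsetP BC); apply: HB xyz.
Qed.

(** The candidate [P] pulls the blocks of [s] back to [A]. Such blocks could have gaps when [A]
    does; that [s] occurs at [pull C A] excludes this. *)
Lemma std_surj (L s : {fset {fset nat}}) (D : {fset nat}) :
  L \in IP D -> C `<=` D -> s \in StIP #|` A| ->
  refines s (std (restr L (pull C A))) -> exists2 P, P \in IP A & std P = s.
Proof.
move=> LD CD sA; have [_ bs ts cs] := IPP _ _ sA.
have BC : pull C A `<=` C by apply/fsubsetP => x; rewrite mem_pull => /andP[].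
have BD := fsubset_trans BC CD.
have A0 : 0 \notin A.
  by apply/negP => /(fsubsetP AC); rewrite mem_seg.
move/(refines_std_restr LD BD sA); rewrite card_pull => /(_ (fsubset_refl _)) H.
have Es E : E \in s -> E `<=` seg 1 #|` A| by rewrite -cs; apply: fcoverS.
have ranked x : x \in A -> exists2 E, E \in s & rank A x \in E.
  by move=> xA; apply/fcoverP; rewrite cs mem_seg rank_gt0 ?rank_le_card.
have cP : fcover [fset pull A E | E in s] = A.
  apply/fsetP => x; apply/fcoverP/idP => [[_ /imfsetP[/= E _ ->]]|xA].
    by rewrite mem_pull => /andP[].
  have [E Es' xE] := ranked x xA.
  by exists (pull A E); rewrite ?mem_pull ?xA //; apply/imfsetP; exists E.
exists [fset pull A E | E in s].
  apply/IPP; split=> //.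
  - move=> _ /imfsetP[/= E Ein ->]; have [En0 cE] := bs _ Ein.
    split; first by apply: pull_neq0 => //; apply: Es.
    move=> x y z; rewrite !mem_pull => /andP[xA xE] /andP[zA zE] /andP[xy yz].
    have lift k : k \in A -> rank A k \in E ->
        exists k', [/\ k' \in C, rank C k' = k & k' \in pull (pull C A) E].
      move=> kA kE; have [k' k'C eq_k] := rank_onto (fsubsetP AC _ kA).
      by exists k'; rewrite !mem_pull k'C eq_k kA rank_pull // eq_k.
    have [x' [x'C eq_x x'E]] := lift x xA xE; have [z' [z'C eq_z z'E]] := lift z zA zE.
    have : y \in seg 1 #|` C|.
      apply: (@seg_convex _ _ x y z); rewrite ?xy //; exact: (fsubsetP AC).
    case/rank_onto => y' y'C eq_y; have [_ HB] := H E Ein.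
    (* Convexity is tested at the points [x'], [y'], [z'] of [C] with ranks [x], [y], [z]:
       consecutiveness there puts [y'] in [pull C A], that is, [y] in [A]. *)
    have : y' \in pull C A.
      apply: (HB x' y' z') => //.
      by rewrite -(rank_mono x'C y'C) -(rank_mono y'C z'C) eq_x eq_y eq_z xy.
    rewrite mem_pull eq_y y'C /= => yA; rewrite yA /=.
    by apply: cE xE zE _; rewrite !rank_le.
  move=> _ _ /imfsetP[/= E Ein ->] /imfsetP[/= F Fin ->] x.
  rewrite !mem_pull => /andP[_ xE] /andP[_ xF].
  by rewrite (ts E F Ein Fin _ xE xF).
apply/fsetP => E; rewrite /std cP.
have rank_pullE F : F \in s -> [fset rank A x | x in pull A F] = F.
  move=> Fs; apply/fsetP => k; apply/imfsetP/idP => /= [[x]|kF].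
    by rewrite mem_pull => /andP[_ ?] ->.
  have [x xA eq_k] := rank_onto (fsubsetP (Es _ Fs) _ kF).
  by exists x; rewrite // mem_pull xA eq_k.
apply/imfsetP/idP => /= [[_ /imfsetP[/= F Fs ->] ->]|Ein].
  by rewrite rank_pullE.
by exists (pull A E); rewrite ?rank_pullE //; apply/imfsetP; exists E.
Qed.

End Pull.

Lemma std_inj (A : {fset nat}) : {in IP A &, injective std}.
Proof.
suff sub P Q : P \in IP A -> Q \in IP A -> std P = std Q -> P `<=` Q.
  by move=> P Q PA QA eqPQ; apply/eqP; rewrite eqEfsubset !sub.
move=> /IPP[_ _ _ cP] /IPP[_ _ _ cQ] eqPQ; apply/fsubsetP => E EP.
have : [fset rank A x | x in E] \in std P by apply/imfsetP; exists E; rewrite //= cP.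
rewrite eqPQ => /imfsetP[/= F FQ]; rewrite cQ => eqEF; suff -> : E = F by [].
have EA : {subset E <= A} by rewrite -cP; apply/fsubsetP/fcoverS.
have FA : {subset F <= A} by rewrite -cQ; apply/fsubsetP/fcoverS.
apply/fsetP => x; apply/idP/idP => xE.
  have /imfsetP[/= y yF /rank_inj->//] : rank A x \in [fset rank A x | x in F].
    by rewrite -eqEF; apply/imfsetP; exists x.
  - exact: EA.
  - exact: FA.
have /imfsetP[/= y yF /rank_inj->//] : rank A x \in [fset rank A x | x in E].
  by rewrite eqEF; apply/imfsetP; exists x.
- exact: FA.
- exact: EA.
Qed.

(** * Sets of positions and their enumeration *)

Lemma card_ltn_ord m k : k <= m -> #|[set j : 'I_m | j < k]| = k.
Proof.
move=> km; have -> : [set j : 'I_m | j < k] = [set widen_ord km i | i in 'I_k].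
  apply/setP => j; rewrite inE; apply/idP/imsetP => [jk|[i _ ->]];
    last exact: (ltn_ord i).
  by exists (Ordinal jk) => //; apply: val_inj.
by rewrite card_imset ?card_ord // => i j /(congr1 val)/= /val_inj.
Qed.

Lemma mem_pos n (A : {set 'I_n}) (i : 'I_n) : (i.+1 \in pos A) = (i \in A).
Proof.
by apply/imfsetP/idP => /= [[j jA [/val_inj->]]|iA]; [|exists i].
Qed.

Lemma posP n (A : {set 'I_n}) x :
  reflect (exists2 i : 'I_n, i \in A & x = i.+1) (x \in pos A).
Proof. by apply: (iffP (imfsetP _ _ _ _)). Qed.

Lemma pos_sub n (A : {set 'I_n}) : pos A `<=` seg 1 n.
Proof. by apply/fsubsetP => _ /posP[i _ ->]; rewrite mem_seg /= ltn_ord. Qed.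

Lemma pos_setU n (A B : {set 'I_n}) : pos (A :|: B) = pos A `|` pos B.
Proof.
apply/fsetP => x; rewrite in_fsetU; apply/posP/orP => [[i + ->]|].
  by rewrite inE => /orP[]; [left|right]; rewrite mem_pos.
by case=> /posP[i iA ->]; exists i; rewrite // inE iA ?orbT.
Qed.

Lemma pos_setT n : pos [set: 'I_n] = seg 1 n.
Proof.
apply/eqP; rewrite eqEfsubset pos_sub; apply/fsubsetP => -[|k]; rewrite mem_seg //= => kn.
by apply/posP; exists (Ordinal kn); rewrite ?inE.
Qed.

Lemma enum_val_lt n (A : {set 'I_n}) (i j : 'I_#|A|) :
  (enum_val i < enum_val j) = (i < j).
Proof.
have sA : sorted (fun x y : 'I_n => x < y) (enum A).
  rewrite /enum_mem -enumT; apply: sorted_filter => [y x z|]; first exact: ltn_trans.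
  by rewrite -(@sorted_map _ _ val ltn) val_enum_ord iota_ltn_sorted.
have H (k l : 'I_#|A|) : k < l -> enum_val k < enum_val l.
  have x0 := enum_val k; move=> kl; rewrite !(enum_val_nth x0).
  apply: (@sorted_ltn_nth _ (fun x y : 'I_n => x < y) _ x0 _ sA);
    rewrite ?inE -?cardE // => y x z /=; exact: ltn_trans.
case: (ltngtP i j) => [/H//|/H ji|/val_inj->]; last by rewrite ltnn.
by apply/negbTE; rewrite -leqNgt ltnW.
Qed.

(** Makes [enum_val] the inverse of [rank]; the successors arise because ordinals start at 0,
    positions and ranks at 1. *)
Lemma rank_enum_val n (A : {set 'I_n}) (i : 'I_#|A|) :
  rank (pos A) (enum_val i).+1 = i.+1.
Proof.
have -> : rank (pos A) (enum_val i).+1 = #|` pos [set enum_val j | j in [set j :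
  'I_#|A| | j <= i]]|.
  congr #|` _|; apply/fsetP => x; rewrite !inE /=; apply/andP/posP => [[/posP[k kA ->]]|].
    rewrite ltnS -{1}(enum_rankK_in kA kA) => ki; exists k => //.
    apply/imsetP; exists (enum_rank_in kA k); last by rewrite enum_rankK_in.
    by rewrite inE leqNgt -enum_val_lt -leqNgt.
  case=> _ /imsetP[j + ->] ->; rewrite inE mem_pos enum_valP ltnS => ji.
  by rewrite leqNgt enum_val_lt -leqNgt.
rewrite card_pos card_imset; last exact: enum_val_inj.
exact: (@card_ltn_ord _ i.+1 (ltn_ord i)).
Qed.

(** * Subsets of a set of positions *)

Section SubSubset.

Variables (N : nat) (C : {set 'I_N}).

(** Counterpart of [pull] for sets of ordinals, as [pos_lift_set] shows. *)
Definition lift_set (A : {set 'I_#|C|}) : {set 'I_N} := [set enum_val i | i in A].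

Lemma pos_lift_set A : pos (lift_set A) = pull (pos C) (pos A).
Proof.
apply/fsetP => x; rewrite mem_pull; apply/posP/andP => [[_ /imsetP[i iA ->] ->]|].
  by rewrite mem_pos enum_valP rank_enum_val mem_pos.
case=> /posP[k kC ->]; rewrite -{1}(enum_rankK_in kC kC) rank_enum_val mem_pos => kA.
by exists k => //; apply/imsetP; exists (enum_rank_in kC k); rewrite ?enum_rankK_in.
Qed.

Lemma lift_set_inj : injective lift_set.
Proof. exact/imset_inj/enum_val_inj. Qed.

Lemma lift_set_sub A : lift_set A \subset C.
Proof. by apply/subsetP => _ /imsetP[i _ ->]; apply: enum_valP. Qed.

Lemma lift_setU A B : lift_set (A :|: B) = lift_set A :|: lift_set B.
Proof. exact: imsetU. Qed.

Lemma lift_setT : lift_set [set: 'I_#|C|] = C.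
Proof.
apply/setP => k; apply/imsetP/idP => [[i _ ->]|kC]; first exact: enum_valP.
by exists (enum_rank_in kC k); rewrite ?enum_rankK_in.
Qed.

Lemma lift_set_surj (B : {set 'I_N}) : B \subset C -> exists A, lift_set A = B.
Proof.
move=> /subsetP BC; exists [set i | enum_val i \in B]; apply/setP => k.
apply/imsetP/idP => [[i + ->]|kB]; first by rewrite inE.
by have kC := BC _ kB; exists (enum_rank_in kC k); rewrite ?inE enum_rankK_in.
Qed.

Lemma card_lift_set A : #|lift_set A| = #|A|.
Proof. by rewrite card_imset //; apply: enum_val_inj. Qed.

(** Both sides have the same rank in [pos (lift_set A)]. The cast bridges cardinals that are equal
    but not convertible. *)
Lemma enum_val_lift_set A (i : 'I_#|lift_set A|) :
  enum_val i = enum_val (enum_val (cast_ord (card_lift_set A) i)).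
Proof.
apply/val_inj/succn_inj/(@rank_inj (pos (lift_set A))).
- by rewrite mem_pos enum_valP.
- by rewrite mem_pos imset_f ?enum_valP.
rewrite rank_enum_val pos_lift_set rank_pull ?rank_enum_val ?mem_pos ?enum_valP //.
by rewrite card_pos pos_sub.
Qed.

End SubSubset.

(** * Iterated standardization of permutations and equality of basis elements *)

Lemma perm_order_inj n (p q : 'S_n) :
  (forall i j, (p i < p j) = (q i < q j)) -> p = q.
Proof.
(* A value of a permutation of [{0, ..., n-1}] is the number of smaller values, hence is determined
   by the relative order. *)
move=> pq; have cnt (r : 'S_n) i : r i = #|[set j | r j < r i]| :> nat.
  have -> : [set j | r j < r i] = r @^-1: [set k : 'I_n | k < r i] by apply/setP =>
    j; rewrite !inE.
  rewrite card_preimset; last exact: perm_inj.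
  by rewrite card_ltn_ord // ltnW.
apply/permP => i; apply/val_inj; rewrite /= cnt [RHS]cnt.
by apply: eq_card => j; rewrite !inE pq.
Qed.

Lemma tagged_perm_eq n m (e : n = m) (p : 'S_n) (q : 'S_m) :
  (forall i j, (p i < p j) = (q (cast_ord e i) < q (cast_ord e j))) ->
  Tagged (fun k => 'S_k) p = Tagged (fun k => 'S_k) q.
Proof.
case: m / e q => q pq; rewrite (@perm_order_inj _ p q) // => i j.
by rewrite pq !cast_ord_id.
Qed.

Lemma st_st N (Lam : 'S_N) (C : {set 'I_N}) (A : {set 'I_#|C|}) :
  Tagged (fun k => 'S_k) (st Lam (lift_set A)) =
  Tagged (fun k => 'S_k) (st (st Lam C) A).
Proof.
apply: (tagged_perm_eq (e := card_lift_set A)) => i j.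
by rewrite !st_lt !enum_val_lift_set.
Qed.

(** The tagged permutations already carry the degree, so the partitions can be compared as bare
    sets. *)
Lemma Vinc_eq n m (s : StIP n) (sigma : 'S_n) (t : StIP m) (tau : 'S_m) :
  (Vinc s sigma == Vinc t tau) = (val s == val t) &&
    (Tagged (fun k => 'S_k) sigma == Tagged (fun k => 'S_k) tau).
Proof.
apply/eqP/andP => [e|[/eqP e1 /eqP e2]].
  have nm : n = m := congr1 tag e.
  case: m / nm t tau e => t tau /eqP; rewrite eq_Tagged /= => /eqP[-> ->].
  by rewrite !eqxx.
have nm : n = m := congr1 tag e2.
case: m / nm t tau e1 e2 => t tau /val_inj-> /eqP; rewrite eq_Tagged /= => /eqP->.
by [].
Qed.

(** * Occurrences as indicators, and the double count *)

Definition occurs (N : nat) (L : StIP N) (Lam : 'S_N) (b : vinc) (A : {set 'I_N}) :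
  bool :=
  le_IP (val (tagged b).1) (std (restr (val L) (pos A))) &&
  (Tagged (fun k => 'S_k) (st Lam A) == Tagged (fun k => 'S_k) (tagged b).2).

Lemma GPC_countE N (L : StIP N) (Lam : 'S_N) (b : vinc) :
  GPC_count L Lam b = \sum_(A : {set 'I_N}) occurs L Lam b A.
Proof.
case: b => n [s sigma]; rewrite /GPC_count /= -sum1dep_card big_mkcond /=.
by apply: eq_bigr => A _; rewrite /occurs /=; case: (_ && _).
Qed.

(** At most one term is nonzero, the one where [g] is the partition of [b]. In this form the count
    can be paired with coefficients of the coproduct. *)
Lemma occursE N (L : StIP N) (Lam : 'S_N) (b : vinc) (C : {set 'I_N}) :
  occurs L Lam b C =
  \sum_(g : StIP #|C| | le_IP (val g) (std (restr (val L) (pos C))))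
    (b == Vinc g (st Lam C)) :> nat.
Proof.
case: b => n [s sigma]; rewrite /occurs /=; have [e|ne] := eqVneq; last first.
  rewrite andbF big1 // => g _; apply/eqP; rewrite eqb0; apply: contra ne => /eqP e.
  have nm : n = #|C| := congr1 tag e.
  move/eqP: e; rewrite -[X in X == _]/(Vinc s sigma).
  by rewrite Vinc_eq => /andP[_]; rewrite eq_sym.
rewrite andbT; have nm : #|C| = n := congr1 tag e.
case: n / nm s sigma e => s sigma e;
under eq_bigr do rewrite -[X in X == _]/(Vinc s sigma) Vinc_eq -e eqxx andbT.
rewrite big_mkcond (bigD1 s) //= big1 ?addn0 ?eqxx => [|g]; first by case: ifP.
by rewrite eq_sym -(inj_eq val_inj) /= => /negPf->; case: ifP.
Qed.

Lemma std_restr_IP N (L : StIP N) (C : {set 'I_N}) :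
  std (restr (val L) (pos C)) \in StIP #|C|.
Proof. by rewrite -card_pos; apply/std_IP/(restr_IP (valP L))/pos_sub. Qed.

Lemma fcover_IP (A : {fset nat}) (P : IP A) : fcover (val P) = A.
Proof. by have /IPP[] := valP P. Qed.

(** Exactly one [P] contributes when [b] occurs at [lift_set A], and none otherwise: existence is
    [std_surj], uniqueness [std_inj], and [refines_pull] moves the order condition from [C] to
    [lift_set A]. *)
Lemma sum_std_vinc N (L : StIP N) (Lam : 'S_N) (C : {set 'I_N}) (A : {set 'I_#|C|}) b :
  \sum_(P : IP (pos A)) (refines (val P) (std (restr (val L) (pos C))) &&
     (std_vinc (st Lam C) P == b)) = occurs L Lam b (lift_set A).
Proof.
have AC : pos A `<=` seg 1 #|` pos C| by rewrite card_pos pos_sub.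
have CN := pos_sub C; have LN := valP L.
case: b => n [s sigma]; rewrite -[existT _ _ _]/(Vinc s sigma) /occurs /= st_st.
have [e|ne] := eqVneq; last first.
  by rewrite andbF big1 // => P _; rewrite Vinc_eq (negPf ne) !andbF.
rewrite andbT; have nA : #|A| = n := congr1 tag e.
have cs : fcover (val s) = seg 1 #|A| by rewrite nA fcover_IP.
have sA : val s \in StIP #|` pos A| by rewrite card_pos nA; exact: valP.
rewrite /le_IP cs; have /IPP[_ _ _ ->] := std_restr_IP L (lift_set A).
rewrite card_lift_set eqxx /= pos_lift_set -/(refines _ _).
under eq_bigr do rewrite Vinc_eq /= e eqxx andbT.
have [H|H] := boolP (refines _ _).
  have [P PA eP] := std_surj AC LN CN sA H.
  rewrite (bigD1 [` PA]) //= eP eqxx andbT (refines_pull AC LN CN PA) eP H.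
  rewrite big1 // => Q QP; apply/eqP; rewrite eqb0 negb_and; apply/orP; right.
  apply: contra QP => /eqP eQ; apply/eqP/val_inj/(std_inj (valP Q) PA).
  by rewrite eQ.
rewrite big1 // => P _; rewrite (refines_pull AC LN CN (valP P)).
by have [->|] := eqVneq (std _) (val s); rewrite ?(negPf H) ?andbF.
Qed.

Lemma sum_lift_set N (C : {set 'I_N}) (F : {set 'I_N} -> nat) :
  \sum_(A : {set 'I_#|C|}) F (lift_set A) = \sum_(B : {set 'I_N} | B \subset C) F B.
Proof.
rewrite -(big_imset F (h := @lift_set N C)) /=; last by move=> A B _ _;
  exact: lift_set_inj.
apply: eq_bigl => B; apply/imsetP/idP => [[A _ ->]|/lift_set_surj[A <-]].
  exact: lift_set_sub.
by exists A; rewrite ?inE.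
Qed.

(* A pair (B, B') arises from the unique C = B :|: B'. *)
Lemma sum_pairs N (F F' : {set 'I_N} -> nat) :
  \sum_(C : {set 'I_N}) \sum_(A : {set 'I_#|C|})
    \sum_(A' : {set 'I_#|C|} | A :|: A' == [set: _]) F (lift_set A) * F' (lift_set A') =
  (\sum_B F B) * (\sum_B F' B).
Proof.
transitivity (\sum_(C : {set 'I_N}) \sum_(B : {set 'I_N}) \sum_(B' : {set 'I_N} | B
  :|: B' == C) F B * F' B').
  apply: eq_bigr => C _.
  pose G (B : {set 'I_N}) := \sum_(B' : {set 'I_N} | (B' \subset C) && (B :|: B' ==
    C)) F B * F' B'.
  transitivity (\sum_(A : {set 'I_#|C|}) G (lift_set A)).
    apply: eq_bigr => A _; rewrite /G [RHS]big_mkcondr.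
    rewrite -(sum_lift_set C (fun B' : {set 'I_N} => if lift_set A :|: B' == C then F
      (lift_set A) * F' B' else 0)) -big_mkcond.
    apply: eq_bigl => A'; by rewrite -lift_setU -(inj_eq (@lift_set_inj _ C)) lift_setT.
  rewrite sum_lift_set big_mkcond; apply: eq_bigr => B _; case: ifP => BC.
    by apply: eq_bigl => B'; case: eqP => [<-|]; rewrite ?subsetUr ?andbF.
  by rewrite big1 // => B' /eqP eC; rewrite -eC subsetUl in BC.
rewrite exchange_big big_distrl; apply: eq_bigr => B _ /=.
rewrite big_distrr /= (exchange_big_dep predT) //=; apply: eq_bigr => B' _.
by rewrite (big_pred1 (B :|: B')) // => C; rewrite eq_sym.
Qed.

Lemma glue_le N (L : StIP N) (C : {set 'I_N}) (A A' : {set 'I_#|C|})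
    (P : IP (pos A)) (P' : IP (pos A')) : A :|: A' = [set: _] ->
  le_IP (glue (val P) (val P')) (std (restr (val L) (pos C))) =
  refines (val P) (std (restr (val L) (pos C))) &&
  refines (val P') (std (restr (val L) (pos C))).
Proof.
move=> AA'; have /IPP[_ _ tR cR] := std_restr_IP L C.
rewrite /le_IP -/(refines _ _) refines_glue // fcover_glue !fcover_IP cR.
by rewrite -pos_setU AA' pos_setT eqxx.
Qed.

(** With the sum over [g] innermost, the gluing condition selects a single [g]; [glue_le] then
    splits the order condition, and the sum factors over [P] and [P']. *)
Lemma sum_glue N (L : StIP N) (Lam : 'S_N) (a b : vinc) (C : {set 'I_N}) :
  \sum_(g : StIP #|C| | le_IP (val g) (std (restr (val L) (pos C))))
  \sum_(A : {set 'I_#|C|}) \sum_(A' : {set 'I_#|C|} | A :|: A' == [set: _])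
  \sum_(P : IP (pos A)) \sum_(P' : IP (pos A') | glue (val P) (val P') == val g)
    ((std_vinc (st Lam C) P == a) && (std_vinc (st Lam C) P' == b)) =
  \sum_(A : {set 'I_#|C|}) \sum_(A' : {set 'I_#|C|} | A :|: A' == [set: _])
    occurs L Lam a (lift_set A) * occurs L Lam b (lift_set A').
Proof.
rewrite exchange_big; apply: eq_bigr => A _; rewrite exchange_big.
apply: eq_bigr => A' /eqP AA' /=; rewrite -!sum_std_vinc big_distrl /= exchange_big.
apply: eq_bigr => P _ /=; rewrite big_distrr /= (exchange_big_dep predT) //=.
apply: eq_bigr => P' _.
have gS : glue (val P) (val P') \in StIP #|C|.
  by rewrite /StIP -pos_setT -AA' pos_setU; apply: glue_IP; exact: valP.
rewrite [LHS]big_mkcond (bigD1 [` gS]) //= eqxx andbT big1 ?addn0 => [|g ng].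
  rewrite glue_le //; do 2!case: (refines _ _) => //=; rewrite ?muln0 //.
  by rewrite mulnb.
by case: ifP => // /andP[_ /eqP e]; case/eqP: ng; apply: val_inj.
Qed.

(** * Coefficients of the coproduct and the product formula *)

Local Open Scope ring_scope.

Lemma coeff_Delta (a b : vinc) n (g : StIP n) (gamma : 'S_n) :
  coeff (a, b) (Delta (Vinc g gamma)) =
  (\sum_(A : {set 'I_n}) \sum_(A' : {set 'I_n} | A :|: A' == [set: 'I_n])
    \sum_(P : IP (pos A)) \sum_(P' : IP (pos A') | glue (val P) (val P') == val g)
    ((std_vinc gamma P == a) && (std_vinc gamma P' == b)))%N%:R.
Proof.
rewrite /= raddf_sum natr_sum; apply: eq_bigr => A _.
rewrite raddf_sum natr_sum; apply: eq_bigr => A' _.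
rewrite raddf_sum natr_sum; apply: eq_bigr => P _.
rewrite raddf_sum natr_sum; apply: eq_bigr => P' _.
by rewrite /= coeffU mul1r.
Qed.

Lemma GPC_heart N (L : StIP N) (Lam : 'S_N) (a b : vinc) :
  GPC L Lam (heart << a >> << b >>) =
  \sum_(C : {set 'I_N})
    \sum_(g : StIP #|C| | le_IP (val g) (std (restr (val L) (pos C))))
      coeff (a, b) (Delta (Vinc g (st Lam C))).
Proof.
rewrite /heart !liftU !scale1r /heart_basis.
have fin := Delta_finite a b.
(* [r] lists the finite support of the product, turning the sum over all basis elements into a
   finite one to which linearity applies. *)
pose r := enum_fset (cardinality.fset_set (fun c => coeff (a, b) (Delta c) != 0)).
have r0 c : c \notin r -> coeff (a, b) (Delta c) = 0.
  rewrite (cardinality.in_fset_set fin) => H; apply/eqP; apply: contraNT H => H.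
  exact: classical_sets.mem_set.
rewrite (fsbigop.fsbigE r) ?fset_uniq // => [|c _ /r0->]; last exact: scale0r.
rewrite raddf_sum.
pose K (C : {set 'I_N}) : pred (StIP #|C|) := fun g => le_IP (val g) (std (restr (val
  L) (pos C))).
transitivity (\sum_(c <- r) \sum_(C : {set 'I_N}) \sum_(g : StIP #|C| | K C g)
    coeff (a, b) (Delta c) * (c == Vinc g (st Lam C))%:R).
  rewrite big_mkcond; apply: eq_bigr => c _.
  rewrite classical_sets.in_setT [LHS]/= linearZ /= GPC_basis GPC_countE natr_sum
    mulr_sumr.
  by apply: eq_bigr => C _; rewrite occursE natr_sum mulr_sumr.
rewrite exchange_big; apply: eq_bigr => C _; rewrite exchange_big; apply: eq_bigr => g _.
(* The sum over [r] picks out the coefficient at [c0]; if [c0] is outside [r], that coefficient and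
   the sum both vanish. *)
move: (Vinc _ _) => c0; have [c0r|c0r] := boolP (c0 \in r).
  rewrite (bigD1_seq c0) ?fset_uniq //= eqxx mulr1 big1 ?addr0 // => c /negPf->.
  exact: mulr0.
rewrite (r0 _ c0r) big_seq big1 // => c cr; case: eqP => [e|]; last by rewrite mulr0.
by rewrite e (negPf c0r) in cr.
Qed.

Theorem theorem4p19 (N : nat) (L : StIP N) (Lam : 'S_N)
    (n : nat) (s : StIP n) (sigma : 'S_n)
    (m : nat) (t : StIP m) (tau : 'S_m) :
  (GPC L Lam << Vinc s sigma >> * GPC L Lam << Vinc t tau >>
   = GPC L Lam (heart << Vinc s sigma >> << Vinc t tau >>))%R.
Proof.
(* Both sides become sums over [C], the union of the two occurrences, and agree term by term. *)
rewrite !GPC_basis !GPC_countE -natrM -sum_pairs GPC_heart natr_sum.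
apply: eq_bigr => C _; rewrite -sum_glue natr_sum.
by apply: eq_bigr => g _; rewrite coeff_Delta.
Qed.
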